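(* For every $n\ge1$, the number $u_n$ of rows with the value ''unknown'' in the Kleene truth tables of all bracketed formulae with $n$ distinct variables $p_1,\dots,p_n$ connected by implication is $$u_n=\frac{3^{n-1}}{n}\binom{2n-2}{n-1}.$$
   Context: Truth values are $1$ (true), $0$ (false), $2$ (unknown). The Kleene implication on $\{0,1,2\}$ is: $1\Rightarrow 1=1$, $1\Rightarrow 0=0$, $1\Rightarrow 2=2$; $0\Rightarrow b=1$ for every $b$; $2\Rightarrow 1=1$, $2\Rightarrow 0=2$, $2\Rightarrow 2=2$. A bracketed formula with $n$ distinct variables is a formula obtained from $p_1\Rightarrow p_2\Rightarrow\cdots\Rightarrow p_n$ by a complete bracketing (equivalently, a full binary tree with $n$ leaves labelled $p_1,\dots,p_n$ from left to right and every internal node labelled $\Rightarrow$); for $n=1$ the only one is $p_1$. A row of the truth table of such a formula is an assignment of $\{0,1,2\}$-values to $p_1,\dots,p_n$, and its value is the value of the formula under this assignment. Counting rows in all truth tables means counting pairs (bracketed formula, assignment). *)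

(* Defs.v *)
From HB Require Import structures.
From mathcomp Require Import all_boot all_order all_algebra.
Set Implicit Arguments.
Unset Strict Implicit.
Unset Printing Implicit Defensive.

(* The truth values usually written 0, 1 and 2, in this order. *)
Inductive kleene := KFalse | KTrue | KUnknown.

Definition kleene_code (a : kleene) : option bool :=
  match a with KFalse => Some false | KTrue => Some true | KUnknown => None end.

Definition kleene_decode (o : option bool) : kleene :=
  match o with Some false => KFalse | Some true => KTrue | None => KUnknown end.

Lemma kleene_codeK : cancel kleene_code kleene_decode.
Proof. by case. Qed.

HB.instance Definition _ := Finite.copy kleene (can_type kleene_codeK).

Definition kimp (a b : kleene) : kleene :=
  match a, b with
  | KTrue, _ => b
  | KFalse, _ => KTrue
  | KUnknown, KTrue => KTrue
  | KUnknown, KFalse => KUnknown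
  | KUnknown, KUnknown => KUnknown
  end.

Inductive formula (V : Type) :=
  | Var of V
  | Imp of formula V & formula V.

Fixpoint leaves (V : Type) (f : formula V) : seq V :=
  match f with
  | Var x => [:: x]
  | Imp g h => leaves g ++ leaves h
  end.

Fixpoint value (V : Type) (v : V -> kleene) (f : formula V) : kleene :=
  match f with
  | Var x => v x
  | Imp g h => kimp (value v g) (value v h)
  end.

Fixpoint formula_code (V : Type) (f : formula V) : GenTree.tree V :=
  match f with
  | Var x => GenTree.Leaf x
  | Imp g h => GenTree.Node 0 [:: formula_code g; formula_code h]
  end.

Fixpoint formula_decode (V : Type) (t : GenTree.tree V) : option (formula V) :=
  match t with
  | GenTree.Leaf x => Some (Var x)
  | GenTree.Node _ [:: t1; t2] =>
      match formula_decode t1, formula_decode t2 with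
      | Some g, Some h => Some (Imp g h)
      | _, _ => None
      end
  | _ => None
  end.

Lemma formula_codeK (V : Type) :
  pcancel (@formula_code V) (@formula_decode V).
Proof. by elim=> //= g -> h ->. Qed.

HB.instance Definition _ (V : countType) :=
  Countable.copy (formula V) (pcan_type (@formula_codeK V)).

(* The variables p_1, ..., p_n are the elements of 'I_n, which [enum 'I_n]   *)
(* lists in increasing order.                                                *)
Record bracketed (n : nat) := Bracketed {
  bformula :> formula 'I_n;
  bformulaP : leaves bformula == enum 'I_n
}.

HB.instance Definition _ n := [isSub for @bformula n].
HB.instance Definition _ n := [Countable of bracketed n by <:].

(* [brackets k s] contains every formula whose leaves spell [s], as soon as  *)
(* [size s <= k]; it only serves to show that [bracketed n] is finite.       *)
Fixpoint brackets (V : Type) (k : nat) (s : seq V) : seq (formula V) :=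
  if k is k'.+1 then
    (if s is [:: x] then [:: Var x] else [::]) ++
    flatten [seq [seq Imp g h | g <- brackets k' (take i s),
                                h <- brackets k' (drop i s)]
            | i <- iota 1 (size s).-1]
  else [::].

Lemma size_leaves_gt0 (V : Type) (f : formula V) : 0 < size (leaves f).
Proof. by elim: f => //= g Hg h _; rewrite size_cat addn_gt0 Hg. Qed.

Lemma mem_brackets (V : countType) k (f : formula V) :
  size (leaves f) <= k -> f \in brackets k (leaves f).
Proof.
elim: k f => [|k IHk] f; first by rewrite leqNgt size_leaves_gt0.
case: f => [x|g h] /=; first by rewrite inE eqxx.
have [g0 h0] := (size_leaves_gt0 g, size_leaves_gt0 h).
rewrite size_cat => le_gh; rewrite mem_cat; apply/orP; right.
apply/flattenP; exists [seq Imp g h | g <- brackets k (leaves g),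
                                      h <- brackets k (leaves h)].
  apply/mapP; exists (size (leaves g)).
    rewrite mem_iota g0 /= add1n prednK ?addn_gt0 ?g0 //.
    by rewrite -[X in X < _]addn0 ltn_add2l.
  by rewrite take_size_cat // drop_size_cat.
apply: allpairs_f; apply: IHk; rewrite -ltnS; apply: leq_trans le_gh.
  by rewrite -[X in X < _]addn0 ltn_add2l.
by rewrite -[X in X < _]add0n ltn_add2r.
Qed.

Definition bracketed_enum n : seq (bracketed n) :=
  undup (pmap insub (brackets n (enum 'I_n))).

Lemma bracketed_enumP n : Finite.axiom (bracketed_enum n).
Proof.
apply: Finite.uniq_enumP; first exact: undup_uniq.
move=> f; rewrite mem_undup mem_pmap_sub /= inE.
have /eqP lf := bformulaP f; rewrite -lf; apply: mem_brackets.
by rewrite lf size_enum_ord.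
Qed.

HB.instance Definition _ n := isFinite.Build (bracketed n) (@bracketed_enumP n).

Definition unknown_rows (n : nat) : nat :=
  #|[set r : bracketed n * {ffun 'I_n -> kleene}
     | value r.2 r.1 == KUnknown]|.

(* Main.v *)
(** Let [g_n] be the number of all rows, and [t_n], [f_n], [u_n] the numbers of
    rows with value true, false and unknown. Splitting a formula at its root
    gives [u_n = sum_(i + j = n) (t_i u_j + u_i f_j + u_i u_j)] for [n >= 2].
    If [3 u_i = g_i] for all [i < n], exchanging [i] and [j] in the first
    product turns this into [3 u_n = sum_(i + j = n) g_i (t_j + f_j + u_j) = g_n].
    So exactly a third of the rows are unknown, although this fails for
    individual formulae; and [g_n] is [3 ^ n] times a Catalan number. *)
Require Import Defs.
From mathcomp Require Import all_boot all_order all_algebra.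
From mathcomp Require Import ring zify.
Set Implicit Arguments.
Unset Strict Implicit.
Unset Printing Implicit Defensive.
Import GRing.Theory Num.Theory.
Local Open Scope ring_scope.

(** * Convolution of Catalan numbers *)

Lemma mul_central_bin (n : nat) :
  (n.+1 * 'C(2 * n.+1, n.+1) = 2 * (2 * n).+1 * 'C(2 * n, n))%N.
Proof.
have -> : (2 * n.+1 = (2 * n).+2)%N by lia.
(* By this symmetry, both terms of Pascal's rule for the left-hand binomial coincide, whence the
   factor 2. *)
have sym : 'C((2 * n).+1, n.+1) = 'C((2 * n).+1, n).
  by rewrite -bin_sub; [congr 'C(_, _); lia | lia].
have := mul_bin_down (2 * n).+1 n; rewrite /= binS sym.
have -> : ((2 * n).+1 - n = n.+1)%N by lia.
by move=> e; rewrite -mulnA e; ring.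
Qed.

Definition catalan (n : nat) : rat := 'C(2 * n, n)%:R / n.+1%:R.

(* Gosper's antidifference of [i |-> catalan i * catalan (n - i)], taken at
   [m = n.+1]. *)
Definition catalan_gosper (m i : nat) : rat :=
  'C(2 * i, i)%:R * 'C(2 * (m - i), m - i)%:R * (2 * i%:R - m%:R)
  / (2 * m%:R * m.+1%:R).

(** With [j = n - i], [mul_central_bin] turns each product of binomials into a rational multiple of
    ['C(2 * i, i) * 'C(2 * j, j)]; an identity of rational functions in [i] and [j] remains. *)
Lemma catalan_gosper_diff (n i : nat) : (i <= n)%N ->
  catalan_gosper n.+1 i.+1 - catalan_gosper n.+1 i = catalan i * catalan (n - i).
Proof.
move=> le_in; rewrite /catalan_gosper /catalan subSS subSn //.
have -> : n = (i + (n - i))%N by lia.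
move: (n - i)%N => j; rewrite addKn {le_in}.
have cbS k : 'C(2 * k.+1, k.+1)%:R
    = 2 * (2 * k%:R + 1) * 'C(2 * k, k)%:R / (k%:R + 1) :> rat.
  have k0 : k%:R + 1 != 0 :> rat by rewrite natr1 pnatr_eq0.
  apply: (mulIf k0); rewrite mulfVK //.
  have /(congr1 (fun x => x%:R : rat)) := mul_central_bin k.
  by rewrite !natrM -!natr1 natrM mulrC => ->.
rewrite !cbS -!natr1 natrD.
have i0 : i%:R + 1 != 0 :> rat by rewrite natr1 pnatr_eq0.
have j0 : j%:R + 1 != 0 :> rat by rewrite natr1 pnatr_eq0.
have s0 : i%:R + j%:R + 1 != 0 :> rat by rewrite -natrD natr1 pnatr_eq0.
have t0 : i%:R + j%:R + 1 + 1 != 0 :> rat by rewrite -natrD !natr1 pnatr_eq0.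
by field; rewrite ?i0 ?j0 ?s0 ?t0.
Qed.

Lemma catalan_rec (n : nat) :
  \sum_(0 <= i < n.+1) catalan i * catalan (n - i) = catalan n.+1.
Proof.
under eq_big_nat => i /andP[_ lt_in] do rewrite -catalan_gosper_diff //.
(* The two end values are opposite, each half of [catalan n.+1] up to sign. *)
rewrite telescope_sumr // /catalan_gosper /catalan subnn subn0 !muln0 !bin0.
have m0 : n%:R + 1 != 0 :> rat by rewrite natr1 pnatr_eq0.
have s0 : n%:R + 1 + 1 != 0 :> rat by rewrite !natr1 pnatr_eq0.
by rewrite -!natr1; field; rewrite m0 s0.
Qed.

(** * Rows as formulae with truth values at the leaves *)

Fixpoint formula_map (V W : Type) (v : V -> W) (f : formula V) : formula W :=
  match f with
  | Var x => Var (v x)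
  | Imp g h => Imp (formula_map v g) (formula_map v h)
  end.

Lemma leaves_map (V W : Type) (v : V -> W) f :
  leaves (formula_map v f) = map v (leaves f).
Proof. by elim: f => //= g -> h ->; rewrite map_cat. Qed.

Lemma value_map (V : Type) (v : V -> kleene) f :
  value id (formula_map v f) = value v f.
Proof. by elim: f => //= g -> h ->. Qed.

(** Equal images force left subformulae with equally many leaves, so the common list of leaves
    splits at the same place on both sides. The two labellings may differ. *)
Lemma formula_map_inj (V : eqType) (W : Type) (v w : V -> W) f g :
  leaves f = leaves g -> formula_map v f = formula_map w g -> f = g.
Proof.
elim: f g => [x|f1 IH1 f2 IH2] [y|g1 g2] //=; first by case=> ->.
move=> /eqP lfg [e1 e2]; have sz : size (leaves f1) = size (leaves g1).
  by rewrite -(size_map v) -(size_map w) -!leaves_map e1.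
by move: lfg; rewrite eqseq_cat // => /andP[/eqP/IH1-> // /eqP/IH2->].
Qed.

(** The shape of [t] and the list [s] determine [f], so one [f] serves every labelling [v]. *)
Lemma relabel (V W : Type) (t : formula W) (s : seq V) :
  size s = size (leaves t) ->
  exists2 f, leaves f = s
    & forall v : V -> W, map v s = leaves t -> formula_map v f = t.
Proof.
elim: t s => [y|t1 IH1 t2 IH2] s /=.
  by case: s => [|x []] // _; exists (Var x) => //= v [->].
rewrite size_cat => sz; pose k := size (leaves t1).
have sz1 : size (take k s) = k by rewrite size_takel // sz leq_addr.
have sz2 : size (drop k s) = size (leaves t2) by rewrite size_drop sz addKn.
have [f1 l1 m1] := IH1 _ sz1; have [f2 l2 m2] := IH2 _ sz2.
exists (Imp f1 f2) => [|v vs] /=; first by rewrite l1 l2 cat_take_drop.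
rewrite m1 ?m2 //; first by rewrite map_drop vs drop_size_cat.
by rewrite map_take vs take_size_cat.
Qed.

(* [k] is fuel: the list is the intended one when [n <= k]. *)
Fixpoint formulae (A : finType) (k n : nat) : seq (formula A) :=
  if k is k'.+1 then
    (if n == 1%N then [seq Var a | a <- enum A] else [::]) ++
    [seq Imp gh.1 gh.2 | i <- iota 1 n.-1,
      gh <- [seq (g, h) | g <- formulae A k' i, h <- formulae A k' (n - i)]]
  else [::].

Lemma mem_formulae (A : finType) k n (f : formula A) : (n <= k)%N ->
  (f \in formulae A k n) = (size (leaves f) == n).
Proof.
elim: k n f => [|k IHk] n f le_nk.
  by move: le_nk (size_leaves_gt0 f); case: n => //; case: size.
rewrite /= mem_cat; apply/orP/eqP => [[]|].
- by case: eqP => // -> /mapP[a _ ->].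
- case/allpairsPdep=> i [[g h] []]; rewrite mem_iota => /andP[i0 lt_in].
  case/allpairsP=> -[g' h'] /= [+ + [-> ->]] ->.
  rewrite !IHk; try lia.
  by move=> /eqP /= sg /eqP sh; rewrite /= size_cat sg sh; lia.
move: f le_nk => [a|g h] /[swap] /= <-; first by left; rewrite map_f ?mem_enum.
have [g0 h0] := (size_leaves_gt0 g, size_leaves_gt0 h) => le_nk.
right; apply/allpairsPdep; exists (size (leaves g)), (g, h).
move: le_nk; rewrite mem_iota size_cat; split=> //; first lia.
by apply: allpairs_f; rewrite IHk ?addKn ?eqxx //; lia.
Qed.

Lemma formulae_uniq (A : finType) k n : (n <= k)%N -> uniq (formulae A k n).
Proof.
elim: k n => [|k IHk] n le_nk //=; rewrite cat_uniq; apply/and3P; split.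
- by case: eqP => // _; rewrite map_inj_uniq ?enum_uniq // => a b [].
- apply/hasPn => f /allpairsPdep[i [gh [_ _ ->]]].
  by case: eqP => // _; apply/mapP => -[].
apply: allpairs_uniq_dep; first exact: iota_uniq.
  move=> i; rewrite mem_iota => i_in.
  apply: allpairs_uniq; [apply: IHk; lia | apply: IHk; lia |].
  by move=> [? ?] [? ?].
move=> x y /allpairsPdep[i [[g h] [i_in gh_in ->]]].
case/allpairsPdep=> j [[g' h'] [j_in gh'_in ->]] /= [eg eh].
rewrite -{}eg -{}eh in gh'_in *.
(* The number of leaves on the left recovers the split index, so different indices give disjoint
   families. *)
have left_size l : l \in iota 1 n.-1 ->
    (g, h) \in [seq (g1, h1) | g1 <- formulae A k l, h1 <- formulae A k (n - l)] ->
    size (leaves g) = l.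
  rewrite mem_iota => l_in /allpairsP[[g1 h1] /= [g1_in _ [-> _]]].
  by apply/eqP; rewrite -(@mem_formulae A k) //; lia.
by rewrite -(left_size i) // -(left_size j).
Qed.

Lemma formulae_Imp (A : finType) k n :
  formulae A k.+1 n.+2 =
    [seq Imp gh.1 gh.2 | i <- index_iota 1 n.+2,
      gh <- [seq (g, h) | g <- formulae A k i, h <- formulae A k (n.+2 - i)]].
Proof. by []. Qed.

Lemma size_formulae (A : finType) k n : (n < k)%N ->
  (size (formulae A k n.+1))%:R = #|A|%:R ^+ n.+1 * catalan n.
Proof.
elim: k n => // k IHk [|n] lt_nk.
  by rewrite /= cats0 size_map -cardE /catalan bin0 expr1 divff ?mulr1.
rewrite formulae_Imp size_allpairs_dep sumnE big_map.
(* The shift makes the left part have [i.+1] leaves, which matches [catalan i]. *)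
rewrite big_add1 natr_sum -catalan_rec.
rewrite mulr_sumr; apply: eq_big_nat => i /andP[_ lt_in].
rewrite size_allpairs natrM IHk; last lia.
have -> : (n.+2 - i.+1 = (n - i).+1)%N by lia.
rewrite IHk; last lia.
have -> : (n.+2 = i.+1 + (n - i).+1)%N by lia.
by rewrite exprD; ring.
Qed.

(** * Counting the unknown values *)

Lemma card_kleene : #|{: kleene}| = 3.
Proof.
have /bij_eq_card -> : bijective kleene_code.
  by exists kleene_decode; [exact: kleene_codeK | case=> [[]|]].
by rewrite card_option card_bool.
Qed.

Definition has_value (b : kleene) (f : formula kleene) := value id f == b.

Lemma size_has_value (s : seq (formula kleene)) :
  size s = (count (has_value KTrue) s + count (has_value KFalse) s
            + count (has_value KUnknown) s)%N.
Proof.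
by elim: s => //= f s ->; rewrite /has_value; case: (value id f); rewrite /=; lia.
Qed.

(** An implication is unknown exactly when its antecedent is true and its consequent unknown, or its
    antecedent is unknown and its consequent not true. *)
Lemma count_unknown_Imp (s t : seq (formula kleene)) :
  count (has_value KUnknown)
    [seq Imp gh.1 gh.2 | gh <- [seq (g, h) | g <- s, h <- t]]
  = (count (has_value KTrue) s * count (has_value KUnknown) t
     + count (has_value KUnknown) s
       * (count (has_value KFalse) t + count (has_value KUnknown) t))%N.
Proof.
elim: s => [|g s IHs] //=; rewrite map_cat count_cat {}IHs -map_comp count_map.
set c := count _ t.
suff -> : c = (has_value KTrue g * count (has_value KUnknown) t
    + has_value KUnknown g
      * (count (has_value KFalse) t + count (has_value KUnknown) t))%N by ring.
rewrite /c {c}; elim: t => [|h t IHt] /=; first by rewrite !muln0.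
rewrite {}IHt /has_value /=.
by case: (value id g); case: (value id h); rewrite /=; lia.
Qed.

Lemma count_unknown_formulae k n : (n <= k)%N ->
  (3 * count (has_value KUnknown) (formulae kleene k n)
   = size (formulae kleene k n))%N.
Proof.
elim: k n => // k IHk n le_nk.
case: n le_nk => [|[|n]] le_nk; first by [].
  rewrite /= cats0 count_map size_map -cardE.
  have -> : count (preim (@Var kleene) (has_value KUnknown)) (enum {: kleene}) = 1%N.
    rewrite (eq_count (a2 := pred1 KUnknown)) //.
    by rewrite count_uniq_mem ?enum_uniq ?mem_enum.
  by rewrite card_kleene.
rewrite formulae_Imp count_flatten size_allpairs_dep !sumnE !big_map.
under eq_bigr do rewrite count_unknown_Imp.
under [RHS]eq_bigr do rewrite size_allpairs.
rewrite big_split /=.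
(* Only the sum of the [t_i u_j] is reversed; the summand becomes [u_i (t_j + f_j + u_j)]. *)
rewrite [X in (_ * (X + _))%N]big_nat_rev -big_split big_distrr /=.
apply: eq_big_nat => i /andP[i0 lt_in].
have -> : (1 + n.+2 - i.+1 = n.+2 - i)%N by lia.
have -> : (n.+2 - (n.+2 - i) = i)%N by lia.
rewrite -(IHk i); last lia.
by rewrite [size _]size_has_value; ring.
Qed.

(** Writing the value of each variable at its leaf is injective on rows, because the variables are
    distinct and their order is fixed; it reaches every formula over [kleene] with [n] leaves. *)
Lemma unknown_rowsE (n : nat) :
  unknown_rows n = count (has_value KUnknown) (formulae kleene n n).
Proof.
pose phi (r : bracketed n * {ffun 'I_n -> kleene}) :=
  formula_map r.2 (bformula r.1).
rewrite /unknown_rows cardE -size_filter -(size_map phi); apply/perm_size.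
apply: uniq_perm.
- rewrite map_inj_uniq ?enum_uniq // => -[f v] [g w]; rewrite /phi /= => e.
  have lf := eqP (bformulaP f); have lg := eqP (bformulaP g).
  have fg : f = g.
    by apply: val_inj; apply: formula_map_inj e; rewrite lf lg.
  congr (_, _); first exact: fg.
  apply/ffunP => i.
  have /eq_in_map -> // : map v (enum 'I_n) = map w (enum 'I_n).
    by rewrite -{1}lf -lg -!leaves_map e.
  by rewrite mem_enum.
- by rewrite filter_uniq ?formulae_uniq.
move=> t; rewrite mem_filter mem_formulae //; apply/mapP/andP.
  case=> -[f v]; rewrite mem_enum inE /= => val_f ->; rewrite /has_value value_map.
  by rewrite leaves_map size_map (eqP (bformulaP f)) size_enum_ord.
case=> val_t /eqP sz.
have [|f lf mf] := @relabel _ _ t (enum 'I_n); first by rewrite size_enum_ord.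
(* The default is never reached, since [t] has [n] leaves. *)
pose v := [ffun i : 'I_n => nth KUnknown (leaves t) i].
have vt : formula_map v f = t.
  apply: mf; apply: (@eq_from_nth _ KUnknown) => [|i].
    by rewrite size_map size_enum_ord.
  rewrite size_map size_enum_ord => lt_in.
  rewrite (nth_map (Ordinal lt_in)) ?size_enum_ord // ffunE.
  by rewrite nth_enum_ord.
exists (Bracketed (introT eqP lf), v); last by rewrite /phi /= vt.
by rewrite mem_enum inE /= -value_map vt.
Qed.

Theorem corollary3 (n : nat) (hn : (1 <= n)%N) :
  (unknown_rows n)%:R =
    3%:R ^+ (n - 1)%N / n%:R * ('C(2 * n - 2, n - 1))%:R :> rat.
Proof.
case: n hn => // n _; have three0 : 3%:R != 0 :> rat by [].
apply: (mulfI three0); rewrite -natrM unknown_rowsE count_unknown_formulae //.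
rewrite size_formulae // card_kleene.
have -> : (2 * n.+1 - 2 = 2 * n)%N by lia.
by rewrite subn1 /= /catalan exprS -!mulrA [_ / _]mulrC.
Qed.
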